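(* Let $S_1$ and $S_2$ be two fractional order systems $$S_i:\ D_t^{\gamma_i}x_i(t)=f_i(x_i,u_i,t),\quad y_i=h_i(x_i,u_i,t),\qquad i=1,2,$$ which are passive with passivity orders $\beta_1$ and $\beta_2$ and storage functions $V_1$ and $V_2$, respectively. Furthermore, assume $V_1(x_1,0)=V_2(x_2,0)=0$ (the storage functions vanish at the initial time $t=0$ along the trajectories). Then the overall system with the parallel interconnection and the overall system with the feedback interconnection are passive, in the sense that $\int_0^{\tau}u(t)^{T}y(t)\,dt\ge 0$ for every $\tau\ge0$, with $u$ and $y$ the input and output of the overall system.
   Context: For each $i$: $\gamma_i\in(0,1)$, $f_i$ is piecewise continuous in $t$ and locally Lipschitz on a set containing the origin, and $f_i(0,0,t)=0$; all inputs and outputs have the same dimension. For $\alpha\in(0,1)$, $D_t^{\alpha}$ is the Caputo derivative $D_t^{\alpha}g(t)=\frac{1}{\Gamma(1-\alpha)}\int_0^t (t-\tau)^{-\alpha}g'(\tau)\,d\tau$ (componentwise). A system with state $x$, input $u$, output $y$ is passive with order $\beta\in(0,1)$ and storage function $V$ if $V(x,t)$ is positive semi-definite (i.e. $V\ge0$, $V(0,t)=0$) and $u^{T}y\ge D_t^{\beta}V(x,t)$ for all $t\ge 0$ along all trajectories, where $D_t^{\beta}V(x,t)$ is the Caputo derivative of $t\mapsto V(x(t),t)$. Parallel interconnection: the system with state $(x_1^T,x_2^T)^T$, input $u=u_1=u_2$ and output $y=y_1+y_2$. Feedback interconnection: the system with state $(x_1^T,x_2^T)^T$, external input $r$ (which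 plays the role of $u$) and output $y=y_1$, where $u_1=r-y_2$ and $u_2=y_1$. *)

(* Defs.v *)
From HB Require Import structures.
From mathcomp Require Import all_boot all_order all_algebra.
From mathcomp Require Import all_classical all_reals all_analysis.
Set Implicit Arguments.
Unset Strict Implicit.
Unset Printing Implicit Defensive.
Import Order.TTheory GRing.Theory Num.Theory.
Import numFieldNormedType.Exports.
Local Open Scope classical_set_scope.
Local Open Scope ring_scope.

Definition Gamma (R : realType) (a : R) : R :=
  \int[@lebesgue_measure R]_(s in `]0, +oo[) (s `^ (a - 1) * expR (- s)).

(* [abs_cont g t]: g is absolutely continuous on [0, t], in the form customary in
   fractional calculus: g is an indefinite integral of a Lebesgue integrable
   function. *)
Definition abs_cont (R : realType) (g : R -> R) (t : R) : Prop :=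
  exists2 phi : R -> R,
    (@lebesgue_measure R).-integrable `[0, t] (EFin \o phi) &
    forall s : R, 0 <= s <= t ->
      g s = g 0 + \int[@lebesgue_measure R]_(r in `[0, s]) phi r.

Definition caputo_integrand (R : realType) (alpha : R) (g : R -> R) (t s : R) : R :=
  (t - s) `^ (- alpha) * derive1 g s.

Definition caputo (R : realType) (alpha : R) (g : R -> R) (t : R) : R :=
  (Gamma (1 - alpha))^-1 *
  \int[@lebesgue_measure R]_(s in `[0, t]) caputo_integrand alpha g t s.

(* The formula defining the Caputo derivative of g at t is meaningful.
   Without absolute continuity the classical derivative g' (which then exists
   only almost everywhere, if at all) would not determine g. *)
Definition caputo_exists (R : realType) (alpha : R) (g : R -> R) (t : R) : Prop :=
  abs_cont g t /\
  (@lebesgue_measure R).-integrable `[0, t]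
    (EFin \o caputo_integrand alpha g t).

Definition vcaputo_exists (R : realType) (n : nat) (alpha : R)
    (x : R -> 'cV[R]_n) (t : R) : Prop :=
  forall i, caputo_exists alpha (fun s => x s i 0) t.

Definition vcaputo (R : realType) (n : nat) (alpha : R)
    (x : R -> 'cV[R]_n) (t : R) : 'cV[R]_n :=
  \col_i caputo alpha (fun s => x s i 0) t.

Definition dotv (R : realType) (m : nat) (u y : 'cV[R]_m) : R :=
  (u^T *m y) 0 0.

(* On every bounded interval of [0, +oo[: finitely many discontinuities, and
   finite one-sided limits everywhere. *)
Definition piecewise_continuous (R : realType) (n : nat) (g : R -> 'cV[R]_n) : Prop :=
  forall T : R, 0 < T ->
  [/\ exists s : seq R, forall t : R, 0 < t < T -> t \notin s -> {for t, continuous g},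
      forall t : R, 0 <= t < T -> cvg (g r @[r --> t^'+]) &
      forall t : R, 0 < t <= T -> cvg (g r @[r --> t^'-])].

(* Local Lipschitz continuity in (x, u), uniformly for t in compact intervals
   of [0, +oo[.  Every point of D must have a full neighbourhood U on which f
   is Lipschitz: intersecting U with D would make the condition void for
   D = [set 0]. *)
Definition locally_lipschitz_on (R : realType) (n m : nat)
    (f : 'cV[R]_n -> 'cV[R]_m -> R -> 'cV[R]_n)
    (D : set ('cV[R]_n * 'cV[R]_m)) : Prop :=
  forall p, D p -> forall T : R, exists k : R, exists2 U, nbhs p U &
    forall t : R, 0 <= t <= T -> k.-lipschitz_U (fun q => f q.1 q.2 t).

Record fosystem (R : realType) (n m : nat) := FOSystem {
  fo_order : R;
  fo_dyn : 'cV[R]_n -> 'cV[R]_m -> R -> 'cV[R]_n;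
  fo_out : 'cV[R]_n -> 'cV[R]_m -> R -> 'cV[R]_m }.

Definition fo_regular (R : realType) (n m : nat) (S : fosystem R n m) : Prop :=
  [/\ 0 < fo_order S < 1,
      forall x u, piecewise_continuous (fo_dyn S x u),
      exists2 D : set ('cV[R]_n * 'cV[R]_m), D (0, 0) & locally_lipschitz_on (fo_dyn S) D &
      forall t : R, 0 <= t -> fo_dyn S 0 0 t = 0].

(* Signals are functions on R of which only the values on [0, +oo[ matter.
   The state equation is imposed at t > 0 only: at t = 0 the integral defining
   the Caputo derivative is over a single point and hence 0, so that imposing it
   there would force every trajectory to start with f (x 0) (u 0) 0 = 0. *)
Definition trajectory (R : realType) (n m : nat) (S : fosystem R n m)
    (x : R -> 'cV[R]_n) (u y : R -> 'cV[R]_m) : Prop :=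
  (forall t : R, 0 < t -> vcaputo_exists (fo_order S) x t /\
     vcaputo (fo_order S) x t = fo_dyn S (x t) (u t) t) /\
  (forall t : R, 0 <= t -> y t = fo_out S (x t) (u t) t).

Definition pos_semidef (R : realType) (n : nat) (V : 'cV[R]_n -> R -> R) : Prop :=
  forall t : R, 0 <= t -> (forall x, 0 <= V x t) /\ V 0 t = 0.

(* As for the state equation, t = 0 is left out: there the formula for the
   Caputo derivative degenerates to 0, and the inequality would become the
   unrelated requirement 0 <= u(0)^T y(0).  This only weakens the property. *)
Definition passive (R : realType) (n m : nat) (S : fosystem R n m)
    (beta : R) (V : 'cV[R]_n -> R -> R) : Prop :=
  [/\ 0 < beta < 1, pos_semidef V &
      forall x u y, trajectory S x u y -> forall t : R, 0 < t ->
        caputo_exists beta (fun s => V (x s) s) t /\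
        caputo beta (fun s => V (x s) s) t <= dotv (u t) (y t)].

Definition parallel_trajectory (R : realType) (n1 n2 m : nat)
    (S1 : fosystem R n1 m) (S2 : fosystem R n2 m)
    (x : R -> 'cV[R]_(n1 + n2)) (u y : R -> 'cV[R]_m) : Prop :=
  exists u1 u2 y1 y2,
    [/\ trajectory S1 (fun t => usubmx (x t)) u1 y1,
        trajectory S2 (fun t => dsubmx (x t)) u2 y2 &
        forall t : R, 0 <= t -> [/\ u1 t = u t, u2 t = u t & y t = y1 t + y2 t]].

Definition feedback_trajectory (R : realType) (n1 n2 m : nat)
    (S1 : fosystem R n1 m) (S2 : fosystem R n2 m)
    (x : R -> 'cV[R]_(n1 + n2)) (r y : R -> 'cV[R]_m) : Prop :=
  exists u1 u2 y1 y2,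
    [/\ trajectory S1 (fun t => usubmx (x t)) u1 y1,
        trajectory S2 (fun t => dsubmx (x t)) u2 y2 &
        forall t : R, 0 <= t -> [/\ u1 t = r t - y2 t, u2 t = y1 t & y t = y1 t]].

(* The integral is extended-real valued, so +oo is allowed and no
   integrability of u^T y needs to be presupposed. *)
Definition nonneg_supply (R : realType) (m : nat) (u y : R -> 'cV[R]_m) : Prop :=
  forall tau : R, 0 <= tau ->
    (0 <= \int[@lebesgue_measure R]_(t in `[0%R, tau]) (dotv (u t) (y t))%:E)%E.

(* Main.v *)
(* Both interconnections have supply u^T y = u1^T y1 + u2^T y2, so it suffices
   that, for g s = V (x s) s >= 0 with g 0 = 0, the Caputo derivative D^b g has
   a nonnegative integral over [0, tau].  If phi is the density of g, then D^b g
   is, up to the factor 1 / Gamma (1 - b) >= 0, the convolution of s^(-b) with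
   phi, and Fubini's theorem gives
     int_0^tau int_0^t (t - s)^(-b) phi s ds dt
       = int_0^tau s^(-b) (g (tau - s) - g 0) ds >= 0. *)
Require Import Defs.
From HB Require Import structures.
From mathcomp Require Import all_boot all_order all_algebra.
From mathcomp Require Import all_classical all_reals all_analysis.
From mathcomp Require Import measurable_realfun lra.
Import Order.TTheory GRing.Theory Num.Theory.
Import numFieldNormedType.Exports.
Local Open Scope classical_set_scope.
Local Open Scope ring_scope.

(** * Monotonicity of the integral for arbitrary functions *)

Section monotone.
Import HBNNSimple.

(* No measurability is needed because the integral of a nonnegative function
   is a supremum over the simple functions below it. *)
Lemma integral_monotone d (T : measurableType d) (R : realType)
    (mu : {measure set T -> \bar R}) (D : set T) (f g : T -> \bar R) :
  (forall x, D x -> (f x <= g x)%E) ->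
  (\int[mu]_(x in D) f x <= \int[mu]_(x in D) g x)%E.
Proof.
move=> fg.
have mono (p q : T -> \bar R) : (forall x, D x -> (0 <= p x)%E) ->
    (forall x, D x -> (p x <= q x)%E) ->
    (\int[mu]_(x in D) p x <= \int[mu]_(x in D) q x)%E.
  move=> p0 pq; rewrite !ge0_integralE//; last first.
    by move=> x Dx; rewrite (le_trans (p0 _ Dx))// pq.
  apply: ge_ereal_sup => _ [h /= hp <-]; apply: le_ereal_sup_tmp.
  exists (sintegral mu h) => //; exists h => // x /=.
  by rewrite (le_trans (hp x))// !patchE; case: ifPn => // /set_mem /pq.
have fgD : {in D, forall x, (f x <= g x)%E} by move=> x /set_mem /fg.
rewrite integralE [leRHS]integralE leeB//; apply: mono => // x Dx.
  by apply: (funepos_le fgD); rewrite inE.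
by apply: (funeneg_le fgD); rewrite inE.
Qed.

End monotone.

(** * Invariance of the Lebesgue integral under reflections and translations *)

Section reflection.
Context {R : realType}.
Notation mu := (@lebesgue_measure R).

(** Lebesgue measure is determined by its values on the intervals ]a, b], and the preimage of such
    an interval is [c - b, c - a[, of the same length. *)
Lemma lebesgue_measure_reflection (c : R) (A : set R) : measurable A ->
  pushforward mu ((fun x => c - x) : _ -> measurableTypeR R) A = mu A.
Proof.
move=> mA; apply/esym/lebesgue_measure_unique => //=.
  exact: measurable_funB.
move=> ? _ [[a b]] _ <-.
rewrite /pushforward.
have -> : (fun x => c - x) @^-1` `]a, b]%classic = `[c - b, c - a[%classic.
  apply/seteqP; split => x /=; rewrite !in_itv/=.
    by move=> /andP[ax xb]; apply/andP; split; lra.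
  by move=> /andP[ax xb]; apply/andP; split; lra.
rewrite !lebesgue_measure_itv/=.
rewrite !lte_fin ltrD2l ltrN2; case: ifP => // _; rewrite -!EFinB.
congr (_%:E); lra.
Qed.

(** Change of variables along the pushforward measure for nonnegative functions, then splitting into
    positive and negative parts. *)
Lemma integral_reflection (c : R) (f : R -> \bar R) : measurable_fun setT f ->
  (\int[mu]_x f (c - x)%R = \int[mu]_x f x)%E.
Proof.
move=> mf.
have reflect_ge0 (h : R -> \bar R) : measurable_fun setT h ->
    (forall x, 0 <= h x)%E -> (\int[mu]_x h (c - x)%R = \int[mu]_x h x)%E.
  move=> mh h0.
  have mc : measurable_fun setT ((fun x : R => c - x) : _ -> measurableTypeR R).
    exact: measurable_funB.
  rewrite -[LHS]/(\int[mu]_(x in setT) (h \o (fun y => c - y)%R) x)%E.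
  rewrite -[X in integral _ X _](preimage_setT
    ((fun x : R => c - x) : _ -> measurableTypeR R)).
  rewrite -ge0_integral_pushforward//.
  apply: eq_measure_integral => //= A mA _.
  exact: lebesgue_measure_reflection.
rewrite integralE [RHS]integralE; congr (_ - _)%E.
  rewrite -[RHS]reflect_ge0//; last exact: measurable_funepos.
  by apply: eq_integral => x _; rewrite !funeposE.
rewrite -[RHS]reflect_ge0//; last exact: measurable_funeneg.
by apply: eq_integral => x _; rewrite !funenegE.
Qed.

(** A translation is the composite of two reflections: x - c = 0 - (c - x). *)
Lemma integral_translation (c : R) (f : R -> \bar R) : measurable_fun setT f ->
  (\int[mu]_x f (x - c)%R = \int[mu]_x f x)%E.
Proof.
move=> mf; rewrite -[RHS](integral_reflection 0)//.
have mf0 : measurable_fun setT (fun x : R => f (0 - x)).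
  by apply: (measurableT_comp mf); exact: measurable_funB.
rewrite -[RHS](integral_reflection c)//.
by apply: eq_integral => x _; rewrite sub0r opprB.
Qed.

End reflection.

(** * Integrability of the singular kernel *)

Lemma integrable_powRN (R : realType) (b t : R) : b < 1 ->
  (@lebesgue_measure R).-integrable `]0, t] (EFin \o (fun s => s `^ (- b))).
Proof.
move=> b1.
have mpow (D : set R) : measurable_fun D (fun s : R => (s `^ (- b))%:E).
  by apply/measurable_EFinP; apply: measurable_funTS; exact: measurable_powR.
apply/integrableP; split; first exact: mpow.
under eq_integral do rewrite /= ger0_norm ?powR_ge0//.
(* The intervals [F i] stay away from the singularity at 0 and increase to ]0, t]. On each of them
   the antiderivative s^(1-b) / (1-b) bounds the integral by t^(1-b) / (1-b), uniformly in i, and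
   monotone convergence concludes. *)
pose F i := `[i.+1%:R^-1, t]%classic : set R.
have -> : `]0, t]%classic = \bigcup_i F i.
  apply/seteqP; split => [s|s [i _]]; rewrite /F /= !in_itv/=.
    move=> /andP[/ltr_add_invr[i]]; rewrite add0r => si st.
    by exists i => //=; rewrite /F/= in_itv/= (ltW si).
  by move=> /andP[si ->]; rewrite (lt_le_trans _ si)// invr_gt0 ltr0n.
have ndF : nondecreasing_seq F.
  move=> i j ij; apply/subsetPset => s; rewrite /F/= !in_itv/= => /andP[si ->].
  by rewrite (le_trans _ si)// lef_pV2 ?posrE ?ltr0n// ler_nat.
have mF i : measurable (F i) by exact: measurable_itv.
have cF : (\int[@lebesgue_measure R]_(s in F i) (s `^ (- b))%:E @[i --> \oo]
    --> \int[@lebesgue_measure R]_(s in \bigcup_i F i) (s `^ (- b))%:E)%E.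
  by apply: ge0_nondecreasing_set_cvg_integral => // [i|i s _];
    [exact: mpow|rewrite lee_fin powR_ge0].
rewrite -(cvg_lim _ cF)//.
apply: (@le_lt_trans _ _ (t `^ (1 - b) / (1 - b))%:E); last exact: ltry.
apply: lime_le; first by apply/cvg_ex; eexists; exact: cF.
apply: nearW => i.
have i0 : 0 < i.+1%:R^-1 :> R by rewrite invr_gt0 ltr0n.
have [ti|it] := leP t i.+1%:R^-1.
  rewrite (@integral_Sset1 _ _ _ t).
    by rewrite lee_fin divr_ge0 ?powR_ge0// subr_ge0 ltW.
  move=> s; rewrite /F/= in_itv/= => /andP[si st].
  by apply/eqP; rewrite eq_le st (le_trans ti).
have dF (x : R) : 0 < x ->
    is_derive x 1 (fun s => s `^ (1 - b) / (1 - b)) (x `^ (- b)).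
  move=> x0; have dp := is_derive1_powR (1 - b) x0.
  have dm := is_deriveM dp (is_derive_cst (1 - b)^-1 x 1).
  apply: (is_derive_eq dm); rewrite scaler0 add0r /GRing.scale/=.
  by rewrite mulrA mulVf ?mul1r ?subr_eq0 ?gt_eqF//; congr (_ `^ _); lra.
have cF' (x : R) : 0 < x ->
    {for x, continuous (fun s => s `^ (1 - b) / (1 - b))}.
  move=> x0; apply: differentiable_continuous; apply/derivable1_diffP.
  by have [] := dF _ x0.
have cpow (x : R) : 0 < x -> derivable (fun s => s `^ (- b)) x 1.
  by move=> x0; have [] := is_derive1_powR (- b) x0.
rewrite (@continuous_FTC2 _ _ (fun s => s `^ (1 - b) / (1 - b)) _ _ it).
- by rewrite -EFinB lee_fin lerBlDr lerDl divr_ge0 ?powR_ge0// subr_ge0 ltW.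
- apply: derivable_within_continuous => x; rewrite in_itv/= => /andP[ix _].
  by apply: cpow; rewrite (lt_le_trans i0).
- split.
  + move=> x; rewrite in_itv/= => /andP[ix _].
    by have [] := dF _ (lt_trans i0 ix).
  + by apply: cvg_at_right_filter; exact: cF'.
  + by apply: cvg_at_left_filter; apply: cF'; exact: lt_trans it.
- move=> x; rewrite in_itv/= => /andP[ix _].
  by rewrite derive1E; have [_ ->] := dF _ (lt_trans i0 ix).
Qed.

(** * Fubini's theorem for convolutions *)

Section convolution.
Context {R : realType}.
Notation mu := (@lebesgue_measure R).
Variables K phi : R -> R.
Hypotheses (iK : mu.-integrable setT (EFin \o K))
           (iphi : mu.-integrable setT (EFin \o phi)).

Let mK : measurable_fun setT K.
Proof. by apply/measurable_EFinP; exact: measurable_int iK. Qed.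

Let mphi : measurable_fun setT phi.
Proof. by apply/measurable_EFinP; exact: measurable_int iphi. Qed.

(** By Tonelli's theorem with t integrated first: translation invariance turns the inner integral
    into |K s| times the L1 norm of [phi], so the total is the product of the two L1 norms. *)
Lemma integrable_convolution :
  (mu \x mu)%E.-integrable setT (fun p : R * R => (K p.2 * phi (p.1 - p.2))%:E).
Proof.
apply/integrable21ltyP => /=.
  apply/measurable_EFinP; apply: measurable_funM.
    exact: (measurableT_comp mK measurable_snd).
  apply: (measurableT_comp mphi); apply: measurable_funB.
    exact: measurable_fst.
  exact: measurable_snd.
have normE (s : R) : (\int[mu]_t `|(K s * phi (t - s)%R)%:E| =
    `|K s|%:E * \int[mu]_t `|(phi t)%:E|)%E.
  have mn : measurable_fun setT (fun t : R => `|(phi t)%:E|%E).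
    by apply: measurableT_comp => //; exact/measurable_EFinP.
  rewrite -[X in (_ * X)%E](integral_translation s)// -ge0_integralZl//.
    by apply: eq_integral => t _; rewrite /= normrM.
  by apply: (measurableT_comp mn); exact: measurable_funB.
under eq_integral do rewrite normE.
have /integrableP[_ phioo] := iphi.
have /integrableP[_ Koo] := iK.
rewrite ge0_integralZr//; last 2 first.
- by apply/measurable_EFinP; exact: measurableT_comp mK.
- exact: integral_ge0.
by rewrite lte_mul_pinfty// ?integral_ge0// ge0_fin_numE// integral_ge0.
Qed.

Lemma integral_convolution (A : set R) : measurable A ->
  (\int[mu]_(t in A) \int[mu]_s (K s * phi (t - s)%R)%:E =
   \int[mu]_s ((K s)%:E * \int[mu]_(t in A) (phi (t - s)%R)%:E))%E.
Proof.
move=> mA.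
pose f (p : R * R) := (K p.2 * phi (p.1 - p.2))%:E.
have mAT : measurable
    (A `*` [set: R] : set (measurableTypeR R * measurableTypeR R)).
  exact: measurableX.
(* Fubini's theorem is applied on the whole plane, so the domain A of the outer integral is moved
   into the integrand by a restriction. *)
have fi : (mu \x mu)%E.-integrable setT (f \_ (A `*` setT)).
  apply: (iffLR (@integrable_mkcond _
    (measurableTypeR R * measurableTypeR R)%type R _ _ f mAT)).
  exact: (integrableS measurableT mAT _ integrable_convolution).
rewrite [LHS]integral_mkcond.
transitivity (\int[mu]_t \int[mu]_s (f \_ (A `*` setT)) (t, s))%E.
  apply: eq_integral => t _; rewrite patchE; case: ifPn => tA.
    apply: eq_integral => s _; rewrite patchE mem_set//.
    by split => //; exact/set_mem.
  rewrite integral0_eq// => s _; rewrite patchE memNset// => -[/= At _].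
  by move: tA; rewrite mem_set.
rewrite (Fubini fi); apply: eq_integral => s _.
transitivity (\int[mu]_(t in A) f (t, s))%E.
  rewrite [RHS]integral_mkcond; apply: eq_integral => t _.
  rewrite !patchE; congr (if _ then _ else _).
  by apply/idP/idP => /set_mem => [[]|At]; rewrite inE.
rewrite /f/= -integralZl//.
apply: (@integrableS _ _ _ _ setT) => //.
have mphis : measurable_fun setT (fun t : R => (phi (t - s))%:E).
  by apply/measurable_EFinP/(measurableT_comp mphi); exact: measurable_funB.
apply/integrableP; split => //.
have /integrableP[mp] := iphi.
rewrite -(integral_translation s)//.
by apply: measurableT_comp.
Qed.

Lemma integrable_convolutionT :
  mu.-integrable setT (fun t => \int[mu]_s (K s * phi (t - s)%R)%:E)%E.
Proof. exact: (integrable_fubini_F integrable_convolution). Qed.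

End convolution.

(** * Classical derivative and density of an absolutely continuous function *)

(** Almost every point is a Lebesgue point of [phi] extended by zero, and at such a point the
    indefinite integral is differentiable with derivative [phi]. This links the classical derivative
    in [caputo_integrand] to the density in [abs_cont]. *)
Lemma ae_derive1_indefinite_integral (R : realType) (g phi : R -> R) (t : R) :
  (@lebesgue_measure R).-integrable `[0, t] (EFin \o phi) ->
  (forall s, 0 <= s <= t ->
    g s = g 0 + \int[@lebesgue_measure R]_(r in `[0, s]) phi r) ->
  {ae @lebesgue_measure R, forall s, 0 < s < t -> derive1 g s = phi s}.
Proof.
move=> iphi gE.
have : locally_integrable setT (phi \_ `[0, t]).
  by apply: integrable_locally_restrict => //; exact: measurable_itv.
move/lebesgue_differentiation; apply: filterS.
  exact: (ae_filter_ringOfSetsType lebesgue_measure).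
move=> s phis /andP[s0 st].
pose G y := \int[@lebesgue_measure R]_(r in `[0, y]) (phi \_ `[0, t]) r.
have ipatch : (@lebesgue_measure R).-integrable `[0, t]
    (EFin \o (phi \_ `[0, t])).
  have mt : measurable (`[0, t] : set (measurableTypeR R)).
    exact: measurable_itv.
  apply: (eq_integrable mt _ _ _ iphi).
  by move=> x xt; rewrite /= patchE xt.
have [dG GE] := @FTC1_lebesgue_pt _ _ (BLeft 0) _ _ st ipatch s0 phis.
have -> : derive1 g s = derive1 (cst (g 0) + G) s.
  rewrite !derive1E; apply: near_eq_derive.
  have : s \in `]0, t[ by rewrite in_itv/= s0.
  move/near_in_itvoo; apply: filterS => y; rewrite in_itv/= => /andP[y0 yt].
  rewrite gE ?(ltW y0) ?(ltW yt)//; congr (_ + _).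
  apply: eq_Rintegral => r; rewrite inE/= in_itv/= => /andP[r0 ry].
  by rewrite patchE mem_set//= in_itv/= r0 (le_trans ry)// ltW.
rewrite derive1E deriveD// derive_cst add0r -derive1E GE patchE mem_set//=.
by rewrite in_itv/= !ltW.
Qed.

(** * Nonnegative integral of the Caputo derivative *)

Section caputo_supply.
Context {R : realType}.
Notation mu := (@lebesgue_measure R).

(** Substitute r = t - s: as 0 < s, the constraints on t and t - s together amount to 0 <= r <= tau
    - s. When [phi] is the density of g, the right-hand side is g (tau - s) - g 0. *)
Lemma integral_translation_itv (phi : R -> R) (tau s : R) : 0 < s <= tau ->
  mu.-integrable `[0, tau] (EFin \o phi) ->
  (\int[mu]_(t in `]0%R, tau]) ((phi \_ `[0, tau]) (t - s)%R)%:E =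
   (\int[mu]_(r in `[0, tau - s]) phi r)%:E)%E.
Proof.
move=> /andP[s0 st] iphi.
have sub : `[0, tau - s] `<=` `[0, tau].
  by apply: subset_itvl; rewrite bnd_simp; lra.
have iphis : mu.-integrable `[0, tau - s] (EFin \o phi).
  by apply: integrableS iphi => //; exact: measurable_itv.
rewrite /Rintegral fineK; last first.
  by apply: integrable_fin_num => //; exact: measurable_itv.
rewrite [LHS]integral_mkcond [RHS]integral_mkcond.
rewrite -[RHS](integral_translation s); last first.
  apply/(measurable_restrictT _ _).1; first exact: measurable_itv.
  exact: measurable_int iphis.
apply: eq_integral => t _; rewrite !patchE.
have -> : (t - s \in `[0, tau - s]%classic) =
    (t \in `]0, tau]%classic) && (t - s \in `[0, tau]%classic).
  rewrite !mem_setE !in_itv/=.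
  apply/idP/idP => [/andP[? ?]|/andP[/andP[? ?] /andP[? ?]]].
    by apply/andP; split; apply/andP; split; lra.
  by apply/andP; split; lra.
by case: (t \in _) => //=; case: ifP.
Qed.

Variables (b tau : R) (g : R -> R).
Hypotheses (b01 : 0 < b < 1) (g0 : g 0 = 0)
  (g_ge0 : forall s, 0 <= s <= tau -> 0 <= g s)
  (gcap : forall t, 0 < t <= tau -> caputo_exists b g t).

(** Integrability is recorded so that the Caputo derivatives of two storage functions can later be
    added under the integral. *)
Lemma caputo_integral_ge0 : 0 < tau ->
  mu.-integrable `]0, tau] (EFin \o caputo b g) /\
  (0 <= \int[mu]_(t in `]0%R, tau]) (caputo b g t)%:E)%E.
Proof.
move=> tau0.
(* A single density, the one obtained at the final time, represents g on all of [0, tau]. *)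
have [[phi0 iphi0 gE] _] : caputo_exists b g tau.
  by apply: gcap; rewrite tau0 lexx.
have /andP[b0 b1] := b01.
pose K : R -> R := (fun s => s `^ (- b)) \_ `]0, tau].
pose phi : R -> R := phi0 \_ `[0, tau].
have mitv (i : interval R) : measurable ([set` i] : set (measurableTypeR R)).
  exact: measurable_itv.
have iK : mu.-integrable setT (EFin \o K).
  rewrite -restrict_EFin; apply: (iffLR (integrable_mkcond _ (mitv _))).
  exact: integrable_powRN.
have iphi : mu.-integrable setT (EFin \o phi).
  by rewrite -restrict_EFin; apply: (iffLR (integrable_mkcond _ (mitv _))).
have mK : measurable_fun setT K.
  by apply/measurable_EFinP; exact: measurable_int iK.
have mphi : measurable_fun setT phi.
  by apply/measurable_EFinP; exact: measurable_int iphi.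
have gphi := ae_derive1_indefinite_integral _ _ _ _ iphi0 gE.
pose C t := (\int[mu]_s (K s * phi (t - s)%R)%:E)%E.
(* The derivative is replaced by the density almost everywhere; the reflection of s into t - s then
   gives the convolution. The zero extensions confine its integrand to [0, t]: [phi] vanishes for s
   < 0 and K (t - s) for s > t. *)
have CE t : 0 < t <= tau ->
    (\int[mu]_(s in `[0%R, t]) (caputo_integrand b g t s)%:E = C t)%E.
  move=> /andP[t0 tt].
  have [_ icap] : caputo_exists b g t by apply: gcap; rewrite t0.
  have mKphi : measurable_fun setT (fun s : R => (K (t - s) * phi s)%:E).
    apply/measurable_EFinP; apply: measurable_funM => //.
    by apply: (measurableT_comp mK); exact: measurable_funB.
  transitivity (\int[mu]_(s in `[0%R, t]) (K (t - s)%R * phi s)%:E)%E.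
    apply: ae_eq_integral => //; first exact: measurable_int icap.
      exact: measurable_funTS.
    (* The endpoints 0 and t are discarded as null sets: [gphi] covers only the open interval, and
       [K] is cut off at 0. *)
    have nt (x : R) : {ae mu, forall s, s <> x}.
      exists [set x]; split.
      - exact: measurable_set1.
      - exact: lebesgue_measure_set1.
      - by move=> s /contrapT.
    move: gphi (nt 0) (nt t); apply: filterS3.
      exact: (ae_filter_ringOfSetsType mu).
    move=> s gs /eqP s0 /eqP st; rewrite /= in_itv/= !le_eqVlt.
    rewrite [0 == s]eq_sym (negbTE s0) (negbTE st)/= => /andP[{}s0 {}st].
    rewrite /caputo_integrand gs; last by apply/andP; split; lra.
    by rewrite /K /phi !patchE !mem_set//= in_itv/=; apply/andP; split; lra.
  rewrite integral_mkcond/= /C -(integral_reflection t); last first.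
    apply/measurable_EFinP; apply: measurable_funM => //.
    by apply: (measurableT_comp mphi); exact: measurable_funB.
  apply: eq_integral => s _; rewrite subKr patchE mem_setE in_itv/=.
  case: ifPn => //; rewrite negb_and -!ltNge.
  rewrite /K /phi !patchE !mem_setE !in_itv/=.
  case/orP => [s0|ts]; first by rewrite (leNgt 0 s) s0/= mulr0.
  by rewrite (ltNge 0 (t - s)) subr_le0 (ltW ts)/= mul0r.
(* Finiteness identifies the real-valued integral in [caputo] with the extended-real [C t]. *)
have Cfin t : 0 < t <= tau -> C t \is a fin_num.
  move=> tt; rewrite -CE//; have [_ icap] := gcap _ tt.
  by apply: integrable_fin_num icap.
(* As the inverse of 0 is 0, the nonnegativity of [Gamma] suffices. *)
have G0 : 0 <= (Gamma (1 - b))^-1.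
  rewrite invr_ge0 /Gamma; apply: Rintegral_ge0 => s _.
  by rewrite mulr_ge0 ?powR_ge0 ?expR_ge0.
have capE : {in `]0, tau]%classic, forall t,
    (caputo b g t)%:E = ((Gamma (1 - b))^-1%:E * C t)%E}.
  move=> t; rewrite inE/= in_itv/= => tt.
  by rewrite -[X in (_ * X)%E]fineK ?Cfin// -EFinM -CE.
have iC : mu.-integrable `]0, tau] C.
  by apply: (integrableS measurableT (mitv _) _)
    (integrable_convolutionT _ _ iK iphi).
split.
  apply: (eq_integrable (mitv _) (fun t => (Gamma (1 - b))^-1%:E * C t)%E).
    by move=> t tt; rewrite /= capE.
  exact: integrableZl.
have -> : (\int[mu]_(t in `]0%R, tau]) (caputo b g t)%:E =
    \int[mu]_(t in `]0%R, tau]) ((Gamma (1 - b))^-1%:E * C t))%E.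
  by apply: eq_integral => t tt; exact: capE.
rewrite integralZl// mule_ge0//.
(* After the exchange, the integrand at s is K s * g (tau - s) on ]0, tau], because g 0 = 0, and it
   vanishes elsewhere with [K]. *)
rewrite (integral_convolution _ _ iK iphi _ (mitv _)).
apply: integral_ge0 => s _.
have [stau|sn] := boolP (s \in `]0, tau]); last first.
  by rewrite /K patchE memNset ?mul0e//; exact/negP.
have /[!in_itv]/=/andP[s0 st] := stau.
rewrite mule_ge0//.
  by rewrite lee_fin /K patchE mem_set// powR_ge0.
rewrite integral_translation_itv ?s0// lee_fin.
have := gE (tau - s); rewrite g0 add0r => <-; last by apply/andP; split; lra.
by apply: g_ge0; apply/andP; split; lra.
Qed.

End caputo_supply.

(** * Supply of passive systems and of their interconnections *)

(** The witness is the Caputo derivative of the storage function along the trajectory. Hiding it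
    behind an existential removes the passivity order, so that systems of different orders can be
    combined. *)
Lemma passive_supply (R : realType) (n m : nat) (S : fosystem R n m)
    (beta : R) (V : 'cV[R]_n -> R -> R)
    (x : R -> 'cV[R]_n) (u y : R -> 'cV[R]_m) (tau : R) :
  passive S beta V -> trajectory S x u y -> V (x 0) 0 = 0 -> 0 < tau ->
  exists c : R -> R,
    [/\ forall t, 0 < t -> c t <= dotv (u t) (y t),
        (@lebesgue_measure R).-integrable `]0, tau] (EFin \o c) &
        (0 <= \int[@lebesgue_measure R]_(t in `]0%R, tau]) (c t)%:E)%E].
Proof.
move=> [b01 psd pass] traj V0 tau0.
have [|t /andP[t0 _]|ic c0] :=
    caputo_integral_ge0 beta tau (fun s => V (x s) s) b01 V0 _ _ tau0.
- by move=> s /andP[s0 _]; exact: (psd s s0).1.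
- exact: (pass x u y traj t t0).1.
exists (caputo beta (fun s => V (x s) s)); split => // t t0.
exact: (pass x u y traj t t0).2.
Qed.

(* [w] plays the role of the supply, which need not be measurable. *)
Lemma integral_ge0_minorant (R : realType) (w c : R -> R) (tau : R) :
  (forall t, 0 < t -> c t <= w t) ->
  (@lebesgue_measure R).-integrable `]0, tau] (EFin \o c) ->
  (0 <= \int[@lebesgue_measure R]_(t in `]0%R, tau]) (c t)%:E)%E ->
  (0 <= \int[@lebesgue_measure R]_(t in `[0%R, tau]) (w t)%:E)%E.
Proof.
move=> cw ic c0.
(* The bound by w is known only for t > 0; redefining c at the single point 0 extends it to [0, tau]
   without changing the integral. *)
pose l t := if t == 0 then w 0 else c t.
have lc : {in `]0, tau]%classic, forall t, (l t)%:E = (c t)%:E}.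
  by move=> t; rewrite inE/= in_itv/= /l => /andP[t0 _]; rewrite gt_eqF.
apply: (@le_trans _ _
    (\int[@lebesgue_measure R]_(t in `[0%R, tau]) (l t)%:E)%E).
  rewrite -integral_itv_obnd_cbnd.
    apply: le_trans c0 _; apply: integral_monotone => t tt.
    by rewrite lc// inE.
  apply: (eq_measurable_fun (EFin \o c)); last exact: measurable_int ic.
  by move=> t tt; rewrite lc.
apply: integral_monotone => t /=; rewrite in_itv/= lee_fin /l => /andP[t0 _].
by case: eqVneq => [->//|tn0]; rewrite cw// lt_neqAle eq_sym tn0.
Qed.

(** The coupling enters only through the balance of supplies, which both interconnections satisfy;
    the sum of the two minorants is then a minorant of the total supply. *)
Lemma nonneg_supply_interconnection (R : realType) (n1 n2 m : nat)
    (S1 : fosystem R n1 m) (S2 : fosystem R n2 m) (beta1 beta2 : R)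
    (V1 : 'cV[R]_n1 -> R -> R) (V2 : 'cV[R]_n2 -> R -> R)
    (x1 : R -> 'cV[R]_n1) (x2 : R -> 'cV[R]_n2)
    (u1 y1 u2 y2 u y : R -> 'cV[R]_m) :
  passive S1 beta1 V1 -> passive S2 beta2 V2 ->
  trajectory S1 x1 u1 y1 -> trajectory S2 x2 u2 y2 ->
  V1 (x1 0) 0 = 0 -> V2 (x2 0) 0 = 0 ->
  (forall t, 0 <= t ->
    dotv (u t) (y t) = dotv (u1 t) (y1 t) + dotv (u2 t) (y2 t)) ->
  nonneg_supply u y.
Proof.
move=> p1 p2 t1 t2 V10 V20 uy tau; rewrite le_eqVlt => /predU1P[<-|tau0].
  rewrite (@integral_Sset1 _ _ _ 0)// => t.
  by rewrite /= in_itv/= -eq_le => /eqP ->.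
have [c1 [c1w ic1 c10]] := passive_supply _ _ _ _ _ _ _ _ _ tau p1 t1 V10 tau0.
have [c2 [c2w ic2 c20]] := passive_supply _ _ _ _ _ _ _ _ _ tau p2 t2 V20 tau0.
have mI : measurable (`]0, tau] : set (measurableTypeR R)).
  exact: measurable_itv.
apply: (integral_ge0_minorant _ _ (fun t => c1 t + c2 t)) => [t t0||].
- by rewrite uy ?(ltW t0)// lerD ?c1w ?c2w.
- exact: (integrableD mI ic1 ic2).
- by rewrite (integralD_EFin mI ic1 ic2) adde_ge0.
Qed.

Theorem theorem3p12 (R : realType) (n1 n2 m : nat)
    (S1 : fosystem R n1 m) (S2 : fosystem R n2 m)
    (beta1 beta2 : R)
    (V1 : 'cV[R]_n1 -> R -> R) (V2 : 'cV[R]_n2 -> R -> R)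
    (regS1 : fo_regular S1) (regS2 : fo_regular S2)
    (passS1 : passive S1 beta1 V1) (passS2 : passive S2 beta2 V2) :
  (forall (x : R -> 'cV[R]_(n1 + n2)) (u y : R -> 'cV[R]_m),
     parallel_trajectory S1 S2 x u y ->
     V1 (usubmx (x 0)) 0 = 0 -> V2 (dsubmx (x 0)) 0 = 0 ->
     nonneg_supply u y) /\
  (forall (x : R -> 'cV[R]_(n1 + n2)) (r y : R -> 'cV[R]_m),
     feedback_trajectory S1 S2 x r y ->
     V1 (usubmx (x 0)) 0 = 0 -> V2 (dsubmx (x 0)) 0 = 0 ->
     nonneg_supply r y).
Proof.
have dotvDl (a b c : 'cV[R]_m) : dotv (a + b) c = dotv a c + dotv b c.
  by rewrite /dotv linearD/= mulmxDl mxE.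
have dotvDr (a b c : 'cV[R]_m) : dotv a (b + c) = dotv a b + dotv a c.
  by rewrite /dotv mulmxDr mxE.
have dotvC (a b : 'cV[R]_m) : dotv a b = dotv b a.
  by rewrite /dotv !mxE; apply: eq_bigr => i _; rewrite !mxE mulrC.
split=> x u y [u1 [u2 [y1 [y2 [t1 t2 e]]]]] V10 V20.
  apply: (nonneg_supply_interconnection _ _ _ _ _ _ _ _ _ _ _ _ _ _ _ _ _ _
    passS1 passS2 t1 t2 V10 V20) => t t0.
  by have [-> -> ->] := e t t0; rewrite dotvDr.
apply: (nonneg_supply_interconnection _ _ _ _ _ _ _ _ _ _ _ _ _ _ _ _ _ _
  passS1 passS2 t1 t2 V10 V20) => t t0.
(* The internal exchange cancels: (u - y2)^T y1 + y1^T y2 = u^T y1, where u is the external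
   input. *)
by have [-> -> ->] := e t t0; rewrite [dotv (y1 t) _]dotvC -dotvDl subrK.
Qed.
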